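(* Let $H$ be a complex Hilbert space with $\dim H\ge 2$. Let $\mathcal{U}\subset B(H)$ be an open subset with $\mathcal{U}\cap S(H)\neq\emptyset$ and $\Pi(H)\subset\mathcal{U}$. Let $U\subset\mathcal{U}\cap S(H)$ be an operator domain. Suppose that $\phi:\mathcal{U}\to B(H)$ is a holomorphic map with $\phi(U)\subset S(H)$ and $\phi(\Pi(H))\subset\Pi(H)$. If $X,Y\in U$ satisfy $X\le Y$ and $(1-c)X+cY\in U$ for every real number $0\le c\le 1$, then $\phi(X)\le\phi(Y)$.
   Context: $B(H)$ is the algebra of bounded linear operators on $H$ and $S(H)$ the set of bounded self-adjoint operators; topologies are induced by the operator norm, and $\le$ is the usual order on $S(H)$ ($X\le Y$ iff $Y-X$ is positive semidefinite). An operator domain is a nonempty, open (in $S(H)$), connected subset of $S(H)$. $\Pi(H)=\{X+iY: X,Y\in S(H),\ Y\text{ positive and invertible}\}$. Holomorphic means Fréchet differentiable at every point with bounded complex-linear derivative. *)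

(* Defs.v *)
From HB Require Import structures.
From mathcomp Require Import all_boot all_order all_algebra.
From mathcomp Require Import complex.
From mathcomp Require Import boolp classical_sets functions reals topology normedtype derive.

Set Implicit Arguments.
Unset Strict Implicit.
Unset Printing Implicit Defensive.

Import Order.TTheory GRing.Theory Num.Theory.
Import numFieldNormedType.Exports.
Local Open Scope classical_set_scope.
Local Open Scope ring_scope.

Section BoundedOperators.
Context {R : realType} {H : normedModType R[i]}.

Definition is_bounded_operator (f : H -> H) : Prop :=
  linear f /\ exists M : R, forall x : H, `|f x| <= M%:C%C * `|x|.

Definition bounded_operator_pred : {pred H -> H} :=
  fun f => `[< is_bounded_operator f >].

Lemma bounded_operator_submod : submod_closed bounded_operator_pred.
Proof.
split.
  apply/asboolP; split; first by move=> a x y /=; rewrite scaler0 addr0.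
  by exists 0 => x; rewrite mul0r normr0.
move=> a f g /asboolP[lf [M fM]] /asboolP[lg [N gN]]; apply/asboolP; split.
  move=> b x y.
  rewrite -[LHS]/(a *: f (b *: x + y) + g (b *: x + y)).
  rewrite -[RHS]/(b *: (a *: f x + g x) + (a *: f y + g y)).
  by rewrite lf lg !scalerDr !scalerA mulrC addrACA.
have [r ra] : exists r : R, r%:C%C = `|a|.
  by exists (complex.Re `|a|); rewrite RRe_real ?normr_real.
exists (r * M + N) => x.
rewrite -[X in `|X|]/(a *: f x + g x) rmorphD rmorphM /= mulrDl.
rewrite (le_trans (ler_normD _ _))// lerD//.
by rewrite ra normrZ -mulrA ler_wpM2l.
Qed.

HB.instance Definition _ :=
  GRing.isSubmodClosed.Build R[i] (H -> H) bounded_operator_pred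
    bounded_operator_submod.

End BoundedOperators.

Record bounded_operator (R : realType) (H : normedModType R[i]) := BoundedOperator {
  operator_fun :> H -> H ;
  _ : operator_fun \in @bounded_operator_pred R H }.

Notation "''B' ( H )" := (bounded_operator H) (at level 8, format "''B' ( H )").

HB.instance Definition _ (R : realType) (H : normedModType R[i]) :=
  [isSub for @operator_fun R H].
HB.instance Definition _ (R : realType) (H : normedModType R[i]) :=
  [Choice of bounded_operator H by <:].
HB.instance Definition _ (R : realType) (H : normedModType R[i]) :=
  [SubChoice_isSubLmodule of bounded_operator H by <:].

Lemma operator_linear (R : realType) (H : normedModType R[i]) (f : 'B(H)) :
  linear f.
Proof. by case: f => f /= /asboolP[]. Qed.

HB.instance Definition _ (R : realType) (H : normedModType R[i]) (f : 'B(H)) :=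
  GRing.isLinear.Build R[i] H H *:%R (operator_fun f) (operator_linear f).

Section OperatorNorm.
Context {R : realType} {H : normedModType R[i]}.
Implicit Types f g : 'B(H).

(* The norms of H and of 'B(H) take their values in the nonnegative reals of
   R[i], hence the coercions by Re and %:C below. *)
Lemma normRe (x : H) : (complex.Re `|x|)%:C%C = `|x|.
Proof. by apply: RRe_real; rewrite normr_real. Qed.

Definition unit_ball_image f : set R :=
  [set complex.Re `|f x| | x in [set x : H | `|x| <= 1]].

Definition opnorm f : R := sup (unit_ball_image f).

Lemma has_sup_unit_ball_image f : has_sup (unit_ball_image f).
Proof.
split; first by exists (complex.Re `|f 0|), 0 => //=; rewrite normr0 ler01.
have [_ [M fM]] : is_bounded_operator f by case: f => f /= /asboolP.
exists `|M| => _ [x /= x1 <-].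
rewrite -lecR normRe (le_trans (fM x))//.
rewrite (@le_trans _ _ (`|M|%:C%C * `|x|))//.
  by rewrite ler_wpM2r// lecR ler_norm.
by rewrite ler_piMr// ler0c.
Qed.

Lemma opnorm_ge0 f : 0 <= opnorm f.
Proof.
apply: sup_upper_bound; first exact: has_sup_unit_ball_image.
by exists 0 => /=; rewrite ?linear0 normr0 ?ler01.
Qed.

Lemma le_opnorm f x : `|f x| <= (opnorm f)%:C%C * `|x|.
Proof.
have [->|x0] := eqVneq x 0; first by rewrite linear0 !normr0 mulr0.
have nx : 0 < `|x| by rewrite normr_gt0.
rewrite -ler_pdivrMr// mulrC.
suff : (complex.Re `|f (`|x|^-1 *: x)|)%:C%C <= (opnorm f)%:C%C.
  by rewrite normRe linearZ/= normrZ normfV normr_id.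
rewrite lecR; apply: sup_upper_bound; first exact: has_sup_unit_ball_image.
by exists (`|x|^-1 *: x) => //=; rewrite normrZ normfV normr_id mulVf ?gt_eqF.
Qed.

Lemma opnorm_le f (M : R) :
  (forall x, `|x| <= 1 -> `|f x| <= M%:C%C) -> opnorm f <= M.
Proof.
move=> fM; apply: ge_sup; first by have [] := has_sup_unit_ball_image f.
by move=> _ [x /= /fM xM <-]; rewrite -lecR normRe.
Qed.

Let ler_opnormD f g : (opnorm (f + g))%:C%C <= (opnorm f)%:C%C + (opnorm g)%:C%C.
Proof.
rewrite -rmorphD lecR; apply: opnorm_le => x x1.
rewrite -[X in `|X|]/(f x + g x) (le_trans (ler_normD _ _))// rmorphD lerD//.
  by rewrite (le_trans (le_opnorm _ _))// ler_piMr// ler0c opnorm_ge0.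
by rewrite (le_trans (le_opnorm _ _))// ler_piMr// ler0c opnorm_ge0.
Qed.

Let le_opnormZ (a : R[i]) f : (opnorm (a *: f))%:C%C <= `|a| * (opnorm f)%:C%C.
Proof.
have [r ra] : exists r : R, r%:C%C = `|a|.
  by exists (complex.Re `|a|); rewrite RRe_real ?normr_real.
rewrite -ra -rmorphM lecR; apply: opnorm_le => x x1.
rewrite -[X in `|X|]/(a *: f x) normrZ rmorphM /= ra ler_wpM2l//.
by rewrite (le_trans (le_opnorm _ _))// ler_piMr// ler0c opnorm_ge0.
Qed.

Let opnorm0_eq0 f : (opnorm f)%:C%C = 0 :> R[i] -> f = 0.
Proof.
move=> f0; apply/val_inj/funext => x /=; apply/normr0_eq0/le_anti.
by rewrite normr_ge0 andbT (le_trans (le_opnorm _ _))// f0 mul0r.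
Qed.

Let opnormZ (a : R[i]) f : (opnorm (a *: f))%:C%C = `|a| * (opnorm f)%:C%C.
Proof.
apply/le_anti; rewrite le_opnormZ/=.
have [->|a0] := eqVneq a 0; first by rewrite normr0 mul0r ler0c opnorm_ge0.
rewrite -ler_pdivlMl ?normr_gt0// -normfV.
by rewrite (le_trans _ (le_opnormZ _ _))// scalerA mulVf// scale1r.
Qed.

HB.instance Definition _ := Lmodule_isNormed.Build R[i] (bounded_operator H)
  ler_opnormD opnormZ opnorm0_eq0.

Lemma opnormE f : `|f| = (opnorm f)%:C%C.
Proof. by []. Qed.

End OperatorNorm.

(* H is a Hilbert space when moreover [`|u| ^+ 2 = dot u u] for all u; [dot] is
   linear in its first argument and conjugate-linear in the second. *)
Section OperatorOrder.
Context {R : realType} {H : completeNormedModType R[i]}.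
Variable dot : {dot H for Num.conj}.
Implicit Types X Y Z : 'B(H).

Definition is_adjoint X Z : Prop := forall u v, dot (X u) v = dot u (Z v).

Definition selfadjoint : set 'B(H) := [set X | is_adjoint X X].

(* In R[i], [0 <= z] says that z is real and nonnegative. *)
Definition positive_semidefinite X : Prop := forall u, 0 <= dot (X u) u.

Definition operator_le X Y : Prop := positive_semidefinite (Y - X).

Definition invertible X : Prop := exists Z, cancel X Z /\ cancel Z X.

Definition operator_domain (U : set 'B(H)) : Prop :=
  [/\ U !=set0,
      exists2 V : set 'B(H), open V & U = V `&` selfadjoint
    & connected U].

Definition upper_half_space : set 'B(H) :=
  [set Z | exists X Y, [/\ selfadjoint X, selfadjoint Y,
     positive_semidefinite Y, invertible Y & Z = X + 'i%C *: Y]].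

(* [differentiable] over the scalars R[i] asks for a continuous R[i]-linear
   differential. It only depends on the germ of phi at X, so for open D the
   values of the total function phi outside D play no role. *)
Definition holomorphic_on (D : set 'B(H)) (phi : 'B(H) -> 'B(H)) : Prop :=
  forall X, D X -> differentiable phi X.

End OperatorOrder.

(* Main.v *)
Require Import Defs.
From mathcomp Require Import all_boot all_order all_algebra.
From mathcomp Require Import complex.
From mathcomp Require Import boolp classical_sets functions reals topology normedtype derive.
From mathcomp Require Import landau sequences ring lra.

Import Order.TTheory GRing.Theory Num.Theory.
Import numFieldNormedType.Exports.
Local Open Scope classical_set_scope.
Local Open Scope ring_scope.

(** The inequality is infinitesimal: it is enough that, at every point A of the
    segment, Re <phi'(A) Q u, u> >= 0 for every positive semidefinite Q and every
    vector u. Applied to Q = Y - X this says that the function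
    c |-> Re <phi (X + c (Y - X)) u, u> has a nonnegative derivative on
    [0, 1] ([is_derive_Re_form], [is_derive_ge0_le]), so its value at 0, which is
    <phi X u, u>, is at most its value at 1, which is <phi Y u, u>.

    For the differential, let P be positive and invertible and let A be a point
    of U. For small real s > 0 the operator A + i s P lies in the half space, so
    Im <phi (A + i s P) u, u> >= 0. To first order in s this number is
    Im <phi A u, u> + s Re <phi'(A) P u, u>, and its first term vanishes since
    phi A is self-adjoint. Dividing by s gives Re <phi'(A) P u, u> >= 0
    ([Re_differential_ge0]): complex differentiability is used only at the
    boundary point A, where it exchanges the imaginary direction i P for the
    real direction P.

    The operator Q need not be invertible, so the previous step is
    applied to P = Q + e id and e tends to 0
    ([Re_differential_semidefinite_ge0]). That P is invertible is the Lax-Milgram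
    theorem ([coercive_invertible]), obtained here from the contraction principle
    ([complex_contraction_fixpoint]).

    Norms and inner products take their values in R[i]; most estimates are
    carried out in the ordered field R through [rnorm] and [rdot]. *)

(** * Real-valued norms *)

Section RealNorm.
Context {R : realType} {V : normedModType R[i]}.
Implicit Types x y : V.

(** On the space of bounded operators this is the operator norm, by
    conversion. *)
Definition rnorm x : R := complex.Re `|x|.

Lemma rnormE x : (rnorm x)%:C%C = `|x|.
Proof. by apply: RRe_real; rewrite normr_real. Qed.

Lemma rnorm_le x (a : R) : (rnorm x <= a) = (`|x| <= a%:C%C).
Proof. by rewrite -rnormE lecR. Qed.

Lemma rnorm_lt x (a : R) : (rnorm x < a) = (`|x| < a%:C%C).
Proof. by rewrite -rnormE ltcR. Qed.

Lemma rnorm_ge0 x : 0 <= rnorm x.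
Proof. by rewrite -ler0c rnormE. Qed.

Lemma rnormD x y : rnorm (x + y) <= rnorm x + rnorm y.
Proof. by rewrite rnorm_le rmorphD /= !rnormE ler_normD. Qed.

Lemma rnormN x : rnorm (- x) = rnorm x.
Proof. by rewrite /rnorm normrN. Qed.

Lemma rdistC x y : rnorm (x - y) = rnorm (y - x).
Proof. by rewrite /rnorm distrC. Qed.

Lemma rnormZ (a : R) x : rnorm (a%:C%C *: x) = `|a| * rnorm x.
Proof.
by apply: complexI; rewrite rmorphM /= !rnormE normrZ normc_def /= expr0n addr0 sqrtr_sqr.
Qed.

Lemma rnormZi x : rnorm ('i%C *: x) = rnorm x.
Proof.
apply: complexI.
by rewrite !rnormE normrZ normc_def /= expr0n expr1n add0r sqrtr1 mul1r.
Qed.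

Lemma rnorm_eq0 x : rnorm x = 0 -> x = 0.
Proof. by move=> x0; apply/normr0_eq0; rewrite -rnormE x0. Qed.

End RealNorm.

(** * The contraction principle *)

Section Contraction.
Context {R : realType} {V : completeNormedModType R[i]}.

(** The classical argument: the iterates of 0 approach each other geometrically,
    hence converge, and a contraction fixes the limit of its iterates. The
    scalars are R[i], but the ratio q is compared in R. *)
Lemma complex_contraction_fixpoint (f : V -> V) (q : R) : 0 <= q < 1 ->
  (forall x y, rnorm (f x - f y) <= q * rnorm (x - y)) -> exists p, f p = p.
Proof.
move=> /andP[q0 q1] fq.
pose x n := iter n f 0.
pose C := rnorm (x 1%N - x 0%N) / (1 - q).
have C0 : 0 <= C by rewrite divr_ge0 ?rnorm_ge0// subr_ge0 ltW.
have step n : rnorm (x n.+1 - x n) <= C * (q ^+ n - q ^+ n.+1).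
  have -> : C * (q ^+ n - q ^+ n.+1) = q ^+ n * rnorm (x 1%N - x 0%N).
    by rewrite /C exprS; field; rewrite subr_eq0 gt_eqF.
  elim: n => [|n IHn]; first by rewrite expr0 mul1r.
  by rewrite (le_trans (fq _ _))// exprS -mulrA ler_wpM2l.
(* The bound C (q ^ n - q ^ (n + 1)) is chosen so that it telescopes. *)
have tail N m : rnorm (x N - x (m + N)%N) <= C * (q ^+ N - q ^+ (m + N)).
  elim: m => [|m IHm]; first by rewrite !subrr /rnorm normr0 mulr0.
  have -> : x N - x (m.+1 + N)%N =
    (x N - x (m + N)%N) + (x (m + N)%N - x (m + N).+1) by rewrite addrA subrK.
  rewrite (le_trans (rnormD _ _))//.
  have := step (m + N)%N; rewrite rdistC addSn.
  by move: IHm; rewrite !mulrBr; lra.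
have small (e : R) : 0 < e -> exists N, C * q ^+ N < e.
  move=> e0.
  have := @cvg_expr R q; rewrite ger0_norm// => /(_ q1).
  move=> /cvgrPdist_lt /(_ (e / (C + 1))) /=.
  rewrite divr_gt0// ?ltr_wpDl// => /(_ isT) [N _ /(_ N)] /=.
  rewrite leqnn sub0r normrN ger0_norm ?exprn_ge0// => /(_ isT).
  rewrite ltr_pdivlMr ?ltr_wpDl// => qN; exists N.
  rewrite (le_lt_trans _ qN)// mulrC ler_wpM2l ?exprn_ge0//; lra.
have near_tail (e : R) : 0 < e -> exists N, forall n, (N <= n)%N ->
    rnorm (x N - x n) < e.
  move=> /small[N CN]; exists N => n /subnK <-.
  apply: le_lt_trans (tail _ _) (le_lt_trans _ CN).
  by rewrite ler_wpM2l// gerBl exprn_ge0.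
have /cauchy_cvgP/cvg_ex[p /cvgrPdist_lt xp] : cauchy (x @ \oo).
  apply: cauchy_exP => e e0.
  have [e' ee] : exists e' : R, e'%:C%C = e.
    by exists (complex.Re e); rewrite RRe_real// gtr0_real.
  move: e0; rewrite -ee (ltcR 0) => /near_tail[N xN]; exists (x N).
  exists N => //= n /= /xN; rewrite rnorm_lt => xNn.
  by rewrite -ball_normE.
exists p.
apply/eqP; rewrite -subr_eq0; apply/eqP/rnorm_eq0/le_anti.
rewrite rnorm_ge0 andbT; apply/ler_addgt0Pr => e e0; rewrite add0r.
have e20 : 0 < e / 2 by rewrite divr_gt0.
have := xp (e / 2)%:C%C; rewrite (ltcR 0) => /(_ e20)[N _ xN].
have xNp n : (N <= n)%N -> rnorm (p - x n) < e / 2.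
  by move=> Nn; rewrite rnorm_lt; exact: xN.
have -> : f p - p = (f p - f (x N)) - (p - x N.+1).
  by rewrite opprB addrA subrK.
rewrite (le_trans (rnormD _ _))// rnormN.
have := xNp N (leqnn N); have := xNp N.+1 (leqnSn N); have := fq p (x N).
have : q * rnorm (p - x N) <= rnorm (p - x N) by rewrite ler_piMl ?rnorm_ge0// ltW.
lra.
Qed.

End Contraction.

(** * Inner product estimates *)

Section RealForm.
Context {R : realType} {H : completeNormedModType R[i]}.
Variable dot : {dot H for Num.conj}.
Hypothesis norm_dot : forall u : H, `|u| ^+ 2 = dot u u.

Definition rdot (u v : H) : R := complex.Re (dot u v).

Lemma rdotDl u v w : rdot (u + v) w = rdot u w + rdot v w.
Proof. by rewrite /rdot linearDl raddfD. Qed.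

Lemma rdotNl u w : rdot (- u) w = - rdot u w.
Proof. by rewrite /rdot linearNl raddfN. Qed.

Lemma rdotZl (a : R) u w : rdot (a%:C%C *: u) w = a * rdot u w.
Proof.
by rewrite /rdot linearZl_LR /=; case: (dot u w) => b c /=; rewrite mul0r subr0.
Qed.

Lemma rdotC u v : rdot u v = rdot v u.
Proof.
have Re_conj (z : R[i]) : complex.Re (Num.conj z) = complex.Re z by case: z.
by rewrite /rdot hermC expr0 mul1r Re_conj.
Qed.

Lemma rdotxx u : rdot u u = rnorm u ^+ 2.
Proof. by rewrite /rdot -norm_dot -rnormE -rmorphXn. Qed.

Lemma rnormB_sqr u v : rnorm (u - v) ^+ 2 =
  rnorm u ^+ 2 - 2 * rdot u v + rnorm v ^+ 2.
Proof.
rewrite -!rdotxx rdotDl rdotNl ![rdot _ (_ - _)]rdotC !rdotDl !rdotNl.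
by rewrite (rdotC v u); ring.
Qed.

(** The Cauchy-Schwarz inequality: expand the square of the norm of
    |v| u - |u| v. *)
Lemma rdot_le u v : rdot u v <= rnorm u * rnorm v.
Proof.
have [u0|u0] := eqVneq (rnorm u) 0.
  by rewrite u0 mul0r (rnorm_eq0 _ u0) /rdot linear0l.
have [v0|v0] := eqVneq (rnorm v) 0.
  by rewrite v0 mulr0 rdotC (rnorm_eq0 _ v0) /rdot linear0l.
have uv : 0 < rnorm u * rnorm v.
  by rewrite mulr_gt0// lt_def ?u0 ?v0 rnorm_ge0.
have := sqr_ge0 (rnorm ((rnorm v)%:C%C *: u - (rnorm u)%:C%C *: v)).
rewrite rnormB_sqr !rnormZ !ger0_norm ?rnorm_ge0// rdotZl rdotC rdotZl (rdotC v).
have -> : (rnorm v * rnorm u) ^+ 2 - 2 * (rnorm v * (rnorm u * rdot u v)) +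
    (rnorm u * rnorm v) ^+ 2 =
    2 * (rnorm u * rnorm v) * (rnorm u * rnorm v - rdot u v) by ring.
have uv2 : 0 < 2 * (rnorm u * rnorm v) by rewrite mulr_gt0.
by rewrite (pmulr_rge0 _ uv2) subr_ge0.
Qed.

Lemma rdot_norm_le u v : `|rdot u v| <= rnorm u * rnorm v.
Proof. by rewrite ler_norml rdot_le lerNl -rdotNl -(rnormN u) rdot_le. Qed.

Lemma Im_dot_le u v : complex.Im (dot u v) <= rnorm u * rnorm v.
Proof.
(* Im z is the real part of - i z. *)
have -> : complex.Im (dot u v) = rdot (- ('i%C *: u)) v.
  rewrite rdotNl /rdot linearZl_LR /=.
  by case: (dot u v) => b c /=; ring.
by rewrite (le_trans (rdot_le _ _))// rnormN rnormZi.
Qed.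

Lemma rnorm_op_le (T : 'B(H)) x : rnorm (T x) <= rnorm T * rnorm x.
Proof. by rewrite rnorm_le rmorphM /= !rnormE le_opnorm. Qed.

Lemma Re_form_le (T : 'B(H)) u : `|rdot (T u) u| <= rnorm T * rnorm u ^+ 2.
Proof.
by rewrite (le_trans (rdot_norm_le _ _))// expr2 mulrA ler_wpM2r ?rnorm_ge0 ?rnorm_op_le.
Qed.

Lemma Im_form_le (T : 'B(H)) u :
  complex.Im (dot (T u) u) <= rnorm T * rnorm u ^+ 2.
Proof.
by rewrite (le_trans (Im_dot_le _ _))// expr2 mulrA ler_wpM2r ?rnorm_ge0 ?rnorm_op_le.
Qed.

(** * Self-adjoint, positive and invertible operators *)

(** The Lax-Milgram theorem. For a small step tau > 0 the map
    x |-> x - tau (T x - y) is a contraction, because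
    |w - tau T w|^2 <= (1 - 2 tau e + tau^2 M^2) |w|^2 when |T| <= M, and its
    fixed point solves T x = y. Coercivity also bounds T from below, which gives
    injectivity and the continuity of the inverse. *)
Lemma coercive_invertible (T : 'B(H)) (e : R) : 0 < e ->
  (forall x, e * rnorm x ^+ 2 <= rdot (T x) x) -> invertible T.
Proof.
move=> e0 Te.
have below x : e * rnorm x <= rnorm (T x).
  have [x0|x0] := eqVneq (rnorm x) 0; first by rewrite x0 mulr0 rnorm_ge0.
  have xgt0 : 0 < rnorm x by rewrite lt_def x0 rnorm_ge0.
  rewrite -(ler_pM2r xgt0) -mulrA -expr2.
  exact: le_trans (Te x) (rdot_le _ _).
have Tinj : injective T.
  move=> x y Txy; apply/eqP; rewrite -subr_eq0; apply/eqP/rnorm_eq0/le_anti.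
  have := below (x - y); rewrite linearB /= Txy subrr /rnorm normr0 rnorm_ge0.
  by rewrite andbT pmulr_rle0.
(* Adding e to the norm ensures e <= M, so that t <= 1 below. *)
pose M := rnorm T + e.
have Me : e <= M by rewrite lerDr rnorm_ge0.
have M0 : 0 < M by exact: lt_le_trans Me.
pose t := e / M.
have t0 : 0 < t by rewrite divr_gt0.
have t1 : t <= 1 by rewrite ler_pdivrMr// mul1r.
(* The step tau = e / M^2 minimizes 1 - 2 tau e + tau^2 M^2, with minimum
   1 - t^2, and q is a rational upper bound of its square root. *)
pose q := 1 - t ^+ 2 / 2.
have t2 : t ^+ 2 <= 1 by rewrite expr_le1// ltW.
have t20 : 0 < t ^+ 2 by rewrite exprn_gt0.
have q01 : 0 <= q < 1 by rewrite /q; apply/andP; split; lra.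
pose tau := e / M ^+ 2.
have tau0 : 0 < tau by rewrite divr_gt0// exprn_gt0.
have Tsurj y : exists x, T x = y.
  have [] := complex_contraction_fixpoint (fun x => x - tau%:C%C *: (T x - y)) q q01.
    move=> x x'; set w := x - x'.
    have -> : x - tau%:C%C *: (T x - y) - (x' - tau%:C%C *: (T x' - y)) =
        w - tau%:C%C *: T w.
      rewrite opprD addrACA -opprD -scalerBr [T w]linearB /=.
      by rewrite [in X in _ *: X]opprB [in X in _ *: X]addrA subrK.
    rewrite -(@ler_pXn2r _ 2)// ?nnegrE ?rnorm_ge0 ?mulr_ge0 ?rnorm_ge0 //; last first.
      by case/andP: q01.
    rewrite rnormB_sqr rnormZ ger0_norm ?(ltW tau0)// rdotC rdotZl.
    rewrite [(tau * _) ^+ 2]exprMn [(q * _) ^+ 2]exprMn.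
    have coercive : tau * (e * rnorm w ^+ 2) <= tau * rdot (T w) w.
      by rewrite ler_wpM2l ?(ltW tau0).
    have bounded : tau ^+ 2 * rnorm (T w) ^+ 2 <= tau ^+ 2 * (M * rnorm w) ^+ 2.
      rewrite ler_wpM2l ?sqr_ge0// lerXn2r ?nnegrE ?rnorm_ge0 ?mulr_ge0 ?rnorm_ge0 ?(ltW M0)//.
      by rewrite (le_trans (rnorm_op_le _ _))// ler_wpM2r ?rnorm_ge0// /M lerDl ltW.
    have eq1 : tau * (e * rnorm w ^+ 2) = t ^+ 2 * rnorm w ^+ 2.
      by rewrite /tau /t; field; rewrite gt_eqF.
    have eq2 : tau ^+ 2 * (M * rnorm w) ^+ 2 = t ^+ 2 * rnorm w ^+ 2.
      by rewrite /tau /t; field; rewrite gt_eqF.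
    have qw : q ^+ 2 * rnorm w ^+ 2 =
      rnorm w ^+ 2 - t ^+ 2 * rnorm w ^+ 2 + (t ^+ 2 * rnorm w / 2) ^+ 2.
      by rewrite /q; field.
    have := sqr_ge0 (t ^+ 2 * rnorm w / 2).
    rewrite qw; move: coercive bounded; rewrite eq1 eq2; lra.
  move=> x /eqP; rewrite -subr_eq0 addrAC subrr add0r oppr_eq0 scaler_eq0.
  rewrite -[0]/(0%:C%C) (inj_eq (@complexI _)) gt_eqF//= subr_eq0 => /eqP.
  by exists x.
have [g Tg] := choice Tsurj.
have gT : cancel T g by move=> x; apply: Tinj.
have gB : g \in bounded_operator_pred.
  apply/asboolP; split=> [a x y|].
    by apply: Tinj; rewrite Tg linearP /= !Tg.
  exists e^-1 => x; rewrite -!rnormE -rmorphM lecR ler_pdivlMl//.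
  by rewrite -[in leRHS](Tg x).
by exists (BoundedOperator gB).
Qed.

Lemma invertibleZ (a : R[i]) (P : 'B(H)) : a != 0 -> invertible P ->
  invertible (a *: P).
Proof.
move=> a0 [Q [PQ QP]]; exists (a^-1 *: Q); split=> x.
  rewrite -[LHS]/(a^-1 *: Q (a *: P x)) linearZ /= scalerA mulVf// scale1r.
  exact: PQ.
rewrite -[LHS]/(a *: P (a^-1 *: Q x)) linearZ /= scalerA mulfV// scale1r.
exact: QP.
Qed.

Lemma selfadjointD (A B : 'B(H)) : selfadjoint dot A -> selfadjoint dot B ->
  selfadjoint dot (A + B).
Proof.
move=> Asa Bsa v w; rewrite -[(A + B) v]/(A v + B v) -[(A + B) w]/(A w + B w).
by rewrite linearDl linearDr /= Asa Bsa.
Qed.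

Lemma selfadjointB (A B : 'B(H)) : selfadjoint dot A -> selfadjoint dot B ->
  selfadjoint dot (A - B).
Proof.
move=> Asa Bsa v w; rewrite -[(A - B) v]/(A v - B v) -[(A - B) w]/(A w - B w).
by rewrite linearBl linearBr /= Asa Bsa.
Qed.

Lemma selfadjointZ (a : R) (A : 'B(H)) : selfadjoint dot A ->
  selfadjoint dot (a%:C%C *: A).
Proof.
move=> Asa v w; rewrite [LHS]linearZl_LR [RHS]linearZr_LR /= Asa.
by congr (_ * _); exact/esym/conjc_real.
Qed.

Lemma positive_semidefiniteD (A B : 'B(H)) : positive_semidefinite dot A ->
  positive_semidefinite dot B -> positive_semidefinite dot (A + B).
Proof.
move=> A0 B0 v; rewrite -[(A + B) v]/(A v + B v) linearDl /=.
by rewrite addr_ge0.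
Qed.

Lemma positive_semidefiniteZ (a : R) (A : 'B(H)) : 0 <= a ->
  positive_semidefinite dot A -> positive_semidefinite dot (a%:C%C *: A).
Proof.
by move=> a0 A0 v; rewrite [X in _ <= X]linearZl_LR /= mulr_ge0// ler0c.
Qed.

Lemma selfadjoint_Im (A : 'B(H)) u : selfadjoint dot A ->
  complex.Im (dot (A u) u) = 0.
Proof.
have Im_conj (z : R[i]) : complex.Im (Num.conj z) = - complex.Im z by case: z.
move=> Asa; have := Im_conj (dot u (A u)).
have := hermC dot (A u) u; rewrite expr0 mul1r => <-.
by rewrite -Asa; lra.
Qed.

Lemma upper_half_space_Im (Z : 'B(H)) u : upper_half_space dot Z ->
  0 <= complex.Im (dot (Z u) u).
Proof.
move=> [A [B [Asa _ B0 _ ->]]].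
rewrite -[(A + _) u]/(A u + 'i%C *: B u) linearDl linearZl_LR /= raddfD /=.
rewrite selfadjoint_Im// add0r.
by move: (B0 u); rewrite lecE => /andP[/eqP + +]; case: (dot _ _) => a b /=; lra.
Qed.

Fact id_bounded : (id : H -> H) \in bounded_operator_pred.
Proof. by apply/asboolP; split=> //; exists 1 => x; rewrite mul1r. Qed.

Definition id_op : 'B(H) := BoundedOperator id_bounded.

Lemma selfadjoint_id : selfadjoint dot id_op.
Proof. by []. Qed.

Lemma positive_semidefinite_id : positive_semidefinite dot id_op.
Proof. by move=> v; rewrite -[id_op v]/v -norm_dot exprn_ge0. Qed.

Lemma positive_addid_invertible (Q : 'B(H)) (e : R) : 0 < e ->
  positive_semidefinite dot Q -> invertible (Q + e%:C%C *: id_op).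
Proof.
move=> e0 Q0; apply: (coercive_invertible _ _ e0) => x.
rewrite -[(Q + _) x]/(Q x + e%:C%C *: x) rdotDl rdotZl rdotxx lerDr.
by have := Q0 x; rewrite lecE => /andP[].
Qed.

End RealForm.

(** * Differential calculus *)

Section Calculus.
Context {R : realType}.

Lemma ge0_perturbation (a K : R) : (forall e, 0 < e -> 0 <= a + e * K) -> 0 <= a.
Proof.
move=> aK; apply/ler_addgt0Pr => e e0.
(* The denominator exceeds K and is positive whatever the sign of K. *)
have K1 : 0 < `|K| + 1 by rewrite ltr_wpDl.
have /aK : 0 < e / (`|K| + 1) by rewrite divr_gt0.
move=> /le_trans; apply; rewrite lerD2l mulrAC ler_pdivrMr//.
by rewrite ler_wpM2l ?(ltW e0)// (le_trans (ler_norm K))// lerDl.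
Qed.

Lemma differentiable_estimate (V W : normedModType R[i]) (f : V -> W) a :
  differentiable f a -> forall e : R, 0 < e -> exists2 d : R, 0 < d &
    forall h, rnorm h < d -> rnorm (f (h + a) - f a - 'd f a h) <= e * rnorm h.
Proof.
move=> /diff_locally /eqaddoP df e e0.
have := df e%:C%C; rewrite (ltcR 0) => /(_ e0) /nbhs_norm0P[d d0 fd].
have [d' dd] : exists d' : R, d'%:C%C = d.
  by exists (complex.Re d); rewrite RRe_real// gtr0_real.
exists d'; first by rewrite -(ltcR 0) dd.
move=> h hd; rewrite -lecR rmorphM /= !rnormE.
have := fd h; rewrite /= -dd -rnorm_lt => /(_ hd).
by congr (`|_| <= _); rewrite opprD addrA.
Qed.

Lemma is_derive_estimate (g : R -> R) (c dg : R) :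
  (forall e : R, 0 < e -> exists2 d : R, 0 < d &
    forall h, `|h| < d -> `|g (h + c) - g c - h * dg| <= e * `|h|) ->
  is_derive c 1 g dg.
Proof.
move=> est.
have lim_dg : h^-1 *: (g (h *: 1 + c) - g c) @[h --> 0^'] --> dg.
  apply/cvgrPdist_le => e e0; have [d d0 gd] := est e e0.
  exists d => // h /=; rewrite sub0r normrN => hd h0.
  have hgt0 : 0 < `|h| by rewrite normr_gt0.
  rewrite distrC -(ler_pM2l hgt0) -normrM mulrBr.
  rewrite -[_ *: (_ - _)]/(h^-1 * (g (h * 1 + c) - g c)) mulVKf// mulr1.
  by rewrite [leRHS]mulrC gd.
apply: DeriveDef; first by apply/cvg_ex; exists dg.
exact: cvg_lim lim_dg.
Qed.

Lemma is_derive_ge0_le (g dg : R -> R) (a b : R) : a <= b ->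
  (forall c, a <= c <= b -> is_derive c 1 g (dg c) /\ 0 <= dg c) -> g a <= g b.
Proof.
move=> ab gdg.
have [||c cab] := @MVT_segment R g dg a b ab.
- move=> x; rewrite in_itv /= => /andP[/ltW ax /ltW xb].
  by have [] := gdg x; rewrite ?ax.
- by apply: derivable_within_continuous => x; rewrite in_itv /= => /gdg[[]].
move: cab; rewrite in_itv /= => /gdg[_ dg0] gab.
by rewrite -subr_ge0 gab mulr_ge0// subr_ge0.
Qed.

End Calculus.

(** * The differential at a boundary point of the half space *)

Section HalfSpace.
Context {R : realType} {H : completeNormedModType R[i]}.
Variable dot : {dot H for Num.conj}.
Hypothesis norm_dot : forall u : H, `|u| ^+ 2 = dot u u.
Variables (phi : 'B(H) -> 'B(H)).

Lemma is_derive_Re_form (X Q : 'B(H)) u (c : R) :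
  differentiable phi (X + c%:C%C *: Q) ->
  is_derive c 1 (fun t : R => rdot dot (phi (X + t%:C%C *: Q) u) u)
    (rdot dot ('d phi (X + c%:C%C *: Q) Q u) u).
Proof.
set A := X + c%:C%C *: Q => dphi.
apply: is_derive_estimate => e e0.
pose K := rnorm Q * rnorm u ^+ 2.
have K0 : 0 <= K by rewrite mulr_ge0 ?rnorm_ge0 ?sqr_ge0.
have K1 : 0 < K + 1 by rewrite ltr_wpDl.
have Q1 : 0 < rnorm Q + 1 by rewrite ltr_wpDl ?rnorm_ge0.
(* With this tolerance on phi, the error on the form is at most
   e K / (K + 1) <= e times the increment. *)
pose e' := e / (K + 1).
have e'0 : 0 < e' by rewrite divr_gt0.
have e'K : e' * K <= e by rewrite mulrAC ler_pdivrMr// ler_wpM2l ?(ltW e0)//; lra.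
have [d d0 est] := differentiable_estimate _ _ _ _ dphi _ e'0.
exists (d / (rnorm Q + 1)); first by rewrite divr_gt0.
move=> t; rewrite ltr_pdivlMr// => td.
have tQd : rnorm (t%:C%C *: Q) < d.
  rewrite rnormZ (le_lt_trans _ td)// ler_wpM2l//; lra.
have := est _ tQd; rewrite rnormZ; set E : 'B(H) := _ - _ - _ => Eh.
have -> : rdot dot (phi (X + (t + c)%:C%C *: Q) u) u - rdot dot (phi A u) u -
    t * rdot dot ('d phi A Q u) u = rdot dot (E u) u.
  rewrite -[E u]/(phi (t%:C%C *: Q + A) u - phi A u - 'd phi A (t%:C%C *: Q) u).
  have -> : 'd phi A (t%:C%C *: Q) = t%:C%C *: 'd phi A Q by rewrite [LHS]linearZ.
  have -> : X + (t + c)%:C%C *: Q = t%:C%C *: Q + A.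
    by rewrite /A rmorphD scalerDl addrCA.
  by rewrite !rdotDl !rdotNl -rdotZl.
clearbody E; rewrite (le_trans (Re_form_le _ norm_dot _ _))//.
apply: le_trans (ler_wpM2r (sqr_ge0 _) Eh) _.
have -> : e' * (`|t| * rnorm Q) * rnorm u ^+ 2 = e' * K * `|t| by rewrite /K; ring.
by rewrite ler_wpM2r.
Qed.

Hypothesis phi_half_space :
  phi @` upper_half_space dot `<=` upper_half_space dot.

(** Compare the first-order expansion of Im <phi (A + i s P) u, u> in s, whose
    constant term is zero and whose linear term is s Re <phi'(A) P u, u>, with
    its nonnegativity. *)
Lemma Re_differential_ge0 (A P : 'B(H)) u :
  differentiable phi A -> selfadjoint dot A -> selfadjoint dot (phi A) ->
  selfadjoint dot P -> positive_semidefinite dot P -> invertible P ->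
  0 <= rdot dot ('d phi A P u) u.
Proof.
move=> dphi Asa phiAsa Psa P0 Pinv.
apply: (@ge0_perturbation _ _ (rnorm P * rnorm u ^+ 2)) => e e0.
have [d d0 est] := differentiable_estimate _ _ _ _ dphi _ e0.
have P1 : 0 < rnorm P + 1 by rewrite ltr_wpDl ?rnorm_ge0.
(* The step s keeps i s P within the radius d of the first-order estimate. *)
pose s := d / (rnorm P + 1) / 2.
have s0 : 0 < s by rewrite !divr_gt0.
set h : 'B(H) := 'i%C *: (s%:C%C *: P).
have hnorm : rnorm h = s * rnorm P by rewrite rnormZi rnormZ gtr0_norm.
have hd : rnorm h < d.
  rewrite hnorm /s; have : d / (rnorm P + 1) * rnorm P <= d.
    by rewrite mulrAC ler_pdivrMr// ler_wpM2l ?(ltW d0)//; lra.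
  rewrite [X in _ -> X < _]mulrAC; lra.
have phih : upper_half_space dot (phi (h + A)).
  apply: phi_half_space; exists (h + A) => //; exists A, (s%:C%C *: P).
  split => //; last by rewrite addrC.
  - exact: selfadjointZ.
  - by apply: positive_semidefiniteZ => //; exact: ltW.
  - apply: invertibleZ => //.
    by rewrite -[0]/(0%:C%C) (inj_eq (@complexI _)) gt_eqF.
have := upper_half_space_Im _ _ u phih.
have := est _ hd; set E : 'B(H) := _ - _ - _ => Eh.
have -> : phi (h + A) = phi A + 'i%C *: (s%:C%C *: 'd phi A P) + E.
  have -> : 'i%C *: (s%:C%C *: 'd phi A P) = 'd phi A h.
    by rewrite /h [RHS]linearZ; congr (_ *: _); rewrite [RHS]linearZ.
  have decomp (a b c : 'B(H)) : a = b + c + (a - b - c).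
    by rewrite -[a - b - c]addrA -opprD [RHS]addrC subrK.
  exact: decomp.
clearbody E.
rewrite -[(phi A + _ + _) u]/(phi A u + 'i%C *: (s%:C%C *: 'd phi A P u) + E u).
rewrite !linearDl linearZl_LR /= !raddfD /= selfadjoint_Im// add0r.
have -> : complex.Im ('i%C * dot (s%:C%C *: 'd phi A P u) u) =
    s * rdot dot ('d phi A P u) u.
  by rewrite -rdotZl /rdot; case: (dot _ _) => a b /=; ring.
have : complex.Im (dot (E u) u) <= s * (e * (rnorm P * rnorm u ^+ 2)).
  rewrite (le_trans (Im_form_le _ norm_dot _ _))//.
  have -> : s * (e * (rnorm P * rnorm u ^+ 2)) = e * rnorm h * rnorm u ^+ 2.
    by rewrite hnorm; ring.
  by rewrite ler_wpM2r ?sqr_ge0.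
by move=> remainder form; rewrite -(pmulr_rge0 _ s0) mulrDr (le_trans form)// lerD2l.
Qed.

(** Approximation of Q by the positive invertible operators Q + e id, along
    which the differential is affine in e. *)
Lemma Re_differential_semidefinite_ge0 (A Q : 'B(H)) u :
  differentiable phi A -> selfadjoint dot A -> selfadjoint dot (phi A) ->
  selfadjoint dot Q -> positive_semidefinite dot Q ->
  0 <= rdot dot ('d phi A Q u) u.
Proof.
move=> dphi Asa phiAsa Qsa Q0.
apply: (@ge0_perturbation _ _ (rdot dot ('d phi A id_op u) u)) => e e0.
have : 0 <= rdot dot ('d phi A (Q + e%:C%C *: id_op) u) u.
  apply: Re_differential_ge0 => //.
  - exact/selfadjointD/selfadjointZ/selfadjoint_id.
  - apply: positive_semidefiniteD => //; apply: positive_semidefiniteZ.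
      exact: ltW.
    exact: positive_semidefinite_id.
  - exact: positive_addid_invertible.
have -> : 'd phi A (Q + e%:C%C *: id_op) =
    'd phi A Q + e%:C%C *: 'd phi A id_op.
  by rewrite [LHS]linearD; congr (_ + _); rewrite [LHS]linearZ.
rewrite -[('d phi A Q + _) u]/('d phi A Q u + e%:C%C *: 'd phi A id_op u).
by rewrite rdotDl rdotZl.
Qed.

End HalfSpace.

(** * Monotonicity *)

Theorem theorem2p2 (R : realType) (H : completeNormedModType R[i])
    (dot : {dot H for Num.conj})
    (norm_dot : forall u : H, `|u| ^+ 2 = dot u u)
    (dim_ge2 : exists u v : H, forall a b : R[i],
       a *: u + b *: v = 0 -> a = 0 /\ b = 0)
    (D : set 'B(H)) (D_open : open D)
    (D_selfadjoint : D `&` selfadjoint dot !=set0)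
    (D_half_space : upper_half_space dot `<=` D)
    (U : set 'B(H)) (U_sub : U `<=` D `&` selfadjoint dot)
    (U_domain : operator_domain dot U)
    (phi : 'B(H) -> 'B(H)) (phi_holo : holomorphic_on D phi)
    (phi_U : phi @` U `<=` selfadjoint dot)
    (phi_half_space : phi @` upper_half_space dot `<=` upper_half_space dot)
    (X Y : 'B(H)) (XU : U X) (YU : U Y) (XY : operator_le dot X Y)
    (segU : forall c : R, 0 <= c <= 1 ->
       U ((1 - c)%:C%C *: X + c%:C%C *: Y)) :
  operator_le dot (phi X) (phi Y).
Proof.
move=> u.
have phi_sa Z : U Z -> selfadjoint dot (phi Z).
  by move=> UZ; apply: phi_U; exists Z.
have Usa Z : U Z -> selfadjoint dot Z by move=> /U_sub[].
pose Q := Y - X.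
have Qsa : selfadjoint dot Q by apply: selfadjointB; exact: Usa.
pose A (c : R) := X + c%:C%C *: Q.
have AU c : 0 <= c <= 1 -> U (A c).
  move=> /segU; congr U.
  by rewrite /A /Q scalerBr rmorphB scalerBl scale1r addrAC -addrA.
pose g c := rdot dot (phi (A c) u) u.
have g01 : g 0 <= g 1.
  apply: (@is_derive_ge0_le _ g (fun c => rdot dot ('d phi (A c) Q u) u)) => //.
  move=> c /AU Ac.
  have dphi : differentiable phi (A c) by apply: phi_holo; case: (U_sub _ Ac).
  split; first exact: is_derive_Re_form.
  by apply: Re_differential_semidefinite_ge0 => //; [exact: Usa|exact: phi_sa].
have A0 : A 0 = X by rewrite /A scale0r addr0.
have A1 : A 1 = Y by rewrite /A scale1r /Q addrC subrK.
(* In R[i] the claim also says that the form is real, which holds since phi X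
   and phi Y are self-adjoint. *)
rewrite -[(phi Y - _) u]/(phi Y u - phi X u) linearBl lecE.
rewrite !raddfB /= !selfadjoint_Im ?subrr ?eqxx//=; try exact: phi_sa.
by move: g01; rewrite /g A0 A1 /rdot subr_ge0.
Qed.
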